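(* Let $k\ge 1$ and $n_1,\dots,n_k\in\mathbb{Z}$. The group \[ G=\left\langle a,t,b_1,\dots,b_k \;\middle|\; at=ta,\; b_1^{-1}tb_1=a^{n_1}t,\;\dots,\; b_k^{-1}tb_k=a^{n_k}t\right\rangle \] is asynchronously automatic.
   Context: Paths $w,u$ in a Cayley graph (parametrized by arc length, eventually constant) asynchronously $K$-fellow travel if there is a non-decreasing proper continuous function $\phi:[0,\infty)\to[0,\infty)$ with $d(w(s),u(\phi(s)))\le K$ for all $s\ge 0$ (so every point of $w$ is within $K$ of some point of $u$ and vice versa). A group $G$ with finite generating set $A$ is asynchronously automatic if there is a regular language $L$ over $A\cup A^{-1}$ whose evaluation map $L\to G$ is surjective and finite-to-one (no element of $G$ has infinitely many preimages), and a constant $K$ such that whenever $w,u\in L$ and $\overline{u}=\overline{wx}$ for some $x\in A\cup A^{-1}\cup\{1\}$, the paths of $w$ and $u$ in the Cayley graph asynchronously $K$-fellow travel. Such groups are called linearly mismatched free-by-cyclic groups in the paper. *)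

(* Defs.v *)
From HB Require Import structures.
From mathcomp Require Import all_boot all_order all_algebra.
From mathcomp Require Import all_classical all_reals all_analysis.
From mathcomp Require Import Rstruct Rstruct_topology.
Set Implicit Arguments. Unset Strict Implicit. Unset Printing Implicit Defensive.
Import Order.TTheory GRing.Theory Num.Theory.
Local Open Scope classical_set_scope.
Local Open Scope ring_scope.

Notation R := Rdefinitions.R.

Section Presentation.
Variable gen : finType.

(* a letter of A ∪ A^{-1}: (generator, is_inverse) *)
Definition letter := (gen * bool)%type.
Definition word := seq letter.
Definition inv_letter (x : letter) : letter := (x.1, ~~ x.2).

Variable rels : seq word.

Inductive eqG : word -> word -> Prop :=
| eqG_refl w : eqG w w
| eqG_sym w u : eqG w u -> eqG u w
| eqG_trans w u v : eqG w u -> eqG u v -> eqG w v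
| eqG_free u v x : eqG (u ++ x :: inv_letter x :: v) (u ++ v)
| eqG_rel u v r : r \in rels -> eqG (u ++ r ++ v) (u ++ v).

Definition vdist_le (g h : word) (n : nat) : Prop :=
  exists v : word, (size v <= n)%N /\ eqG (g ++ v) h.

(* points of the (geometric) Cayley graph: a vertex, or a point on the edge
   leaving vertex g labelled by the letter x, at distance alpha in [0,1) from g *)
Inductive point := PV of word | PE of word & letter & R.

Definition is_end (P : point) (e : word) (d : R) : Prop :=
  match P with
  | PV g => e = g /\ d = 0
  | PE g x a => (e = g /\ d = a) \/ (e = rcons g x /\ d = 1 - a)
  end.

(* canonical description of an edge point: (base vertex, generator, position
   measured from the base vertex along the edge base --gen--> base*gen) *)
Definition canon (g : word) (x : letter) (a : R) : word * gen * R :=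
  if x.2 then (rcons g x, x.1, 1 - a) else (g, x.1, a).

(* d(P,Q) <= K in the Cayley graph (edges of length 1) *)
Definition close (K : R) (P Q : point) : Prop :=
  (exists g x a h y b,
      P = PE g x a /\ Q = PE h y b /\
      (canon g x a).1.2 = (canon h y b).1.2 /\
      eqG (canon g x a).1.1 (canon h y b).1.1 /\
      `|(canon g x a).2 - (canon h y b).2| <= K)
  \/ (exists e1 d1 e2 d2 (n : nat),
      is_end P e1 d1 /\ is_end Q e2 d2 /\ vdist_le e1 e2 n /\
      d1 + n%:R + d2 <= K).

(* pt_on w s P : P is the point w(s) of the path of w, parametrized by arc
   length and constant after time |w| *)
Definition pt_on (w : word) (s : R) (P : point) : Prop :=
  (exists (i : nat) (x : letter) (rest : word),
      drop i w = x :: rest /\ i%:R <= s /\ s < i.+1%:R /\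
      P = PE (take i w) x (s - i%:R))
  \/ ((size w)%:R <= s /\ P = PV w).

Definition async_fellow_travel (K : R) (w u : word) : Prop :=
  exists phi : R -> R,
    (forall s, 0 <= s -> 0 <= phi s) /\
    (forall s t, 0 <= s -> s <= t -> phi s <= phi t) /\
    {within [set s | 0 <= s], continuous phi} /\
    (forall C : set R, compact C -> compact ([set s | 0 <= s] `&` phi @^-1` C)) /\
    (forall s, 0 <= s -> forall P Q, pt_on w s P -> pt_on u (phi s) Q -> close K P Q).

Record dfa := Dfa {
  dfa_state : finType;
  dfa_start : dfa_state;
  dfa_accept : pred dfa_state;
  dfa_trans : dfa_state -> letter -> dfa_state }.

Definition accepts (D : dfa) (w : word) : bool :=
  @dfa_accept D (foldl (@dfa_trans D) (@dfa_start D) w).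

Definition async_automatic : Prop :=
  exists (D : dfa) (K : R),
    (forall g : word, exists w, accepts D w /\ eqG w g) /\
    (forall g : word, exists s : seq word,
        forall w, accepts D w -> eqG w g -> w \in s) /\
    (forall (w u : word) (x : option letter),
        accepts D w -> accepts D u ->
        eqG u (w ++ (if x is Some y then [:: y] else [::])) ->
        async_fellow_travel K w u).
End Presentation.

(* The group <a, t, b_1..b_k | at=ta, b_i^{-1} t b_i = a^{n_i} t>.
   Generators: 'I_k.+2 with 0 = a, 1 = t, i+2 = b_{i+1}. *)
Definition gen_a (k : nat) : 'I_k.+2 := inord 0.
Definition gen_t (k : nat) : 'I_k.+2 := inord 1.
Definition gen_b (k : nat) (i : 'I_k) : 'I_k.+2 := inord i.+2.

Definition pow_letter (gen : finType) (x : gen) (m : int) : word gen :=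
  match m with
  | Posz p => nseq p (x, false)
  | Negz p => nseq p.+1 (x, true)
  end.

Definition G_rels (k : nat) (n : 'I_k -> int) : seq (word 'I_k.+2) :=
  [:: (gen_a k, false); (gen_t k, false); (gen_a k, true); (gen_t k, true)]
  :: [seq [:: (gen_b i, true); (gen_t k, false); (gen_b i, false); (gen_t k, true)]
            ++ pow_letter (gen_a k) (- n i) | i <- enum 'I_k].

(* Main.v *)
Require Import Defs.
From mathcomp Require Import all_boot all_order all_algebra.
From mathcomp Require Import all_classical all_reals all_analysis.
From mathcomp Require Import Rstruct Rstruct_topology.
From mathcomp Require Import zify ring lra.
From Stdlib Require Setoid.

(* The group is the semidirect product of the free group on [a, b_1, ..., b_k]
   by the infinite cyclic group generated by [t], which fixes [a] and sends
   [b_i] to [b_i a^(n_i)]. Hence every element is uniquely [t^q v] with [v] a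
   reduced word in [a] and the [b_i], and these words form a regular language.
   Right multiplication by [a] or [b_i] changes only the end of the word. Right
   multiplication by [t] turns [t^q v] into [t^(q+1) v'], where [v'] is the
   image of [v] under [b_i -> b_i a^(- n_i)]. For a prefix [p] of [v] with image
   [p'] one has [t^(q+1) p' = t^q p t], so the two paths stay close provided that
   the reduced form of [p'] is close to a prefix of that of [v']. This holds
   because the [b]-letters never cancel and the exponents of the blocks of [a]'s
   change by a bounded amount: [v'] is produced from [v] letter by letter, with
   a bounded power of [a] pending. *)

Set Implicit Arguments.
Unset Strict Implicit.
Unset Printing Implicit Defensive.
Import Order.TTheory GRing.Theory Num.Theory.
Import numFieldNormedType.Exports.
Local Open Scope classical_set_scope.
Local Open Scope ring_scope.

(** * Fellow travelling from discrete data *)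

Section PiecewiseLinear.
Variables (J : nat -> nat) (L : nat).
Hypothesis J_homo : forall i, (J i <= J i.+1)%N.
Hypothesis J_tail : forall i, (L <= i)%N -> J i.+1 = (J i).+1.

Definition ramp (x : R) : R := Num.min (Num.max x 0) 1.

(** The piecewise linear interpolation of [J], written with clamped ramps so that monotonicity and
    continuity hold term by term. The last summand gives slope 1 beyond [L], whence properness. *)
Definition interp (s : R) : R :=
  (J 0)%:R + \sum_(j < L) (J j.+1 - J j)%:R * ramp (s - j%:R)
  + Num.max (s - L%:R) 0.

Lemma ramp_homo x y : x <= y -> ramp x <= ramp y.
Proof. by move=> xy; rewrite /ramp le_min2 // le_max2. Qed.

Lemma ramp_ge0 x : 0 <= ramp x.
Proof. by rewrite /ramp le_min le_max lexx orbT ler01. Qed.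

Lemma interp_homo s t : s <= t -> interp s <= interp t.
Proof.
move=> st; apply: lerD; last by rewrite le_max2 // lerB.
rewrite lerD2l ler_sum // => j _.
by rewrite ler_wpM2l ?ler0n // ramp_homo // lerB.
Qed.

Lemma ramp_le0 x : x <= 0 -> ramp x = 0.
Proof. by move=> x0; rewrite /ramp max_r // min_l. Qed.

Lemma ramp_ge1 x : 1 <= x -> ramp x = 1.
Proof. by move=> x1; rewrite /ramp min_r // le_max x1. Qed.

Lemma ramp_natS (i j : nat) :
  ramp (i.+1%:R - j%:R) - ramp (i%:R - j%:R) = (j == i)%:R.
Proof.
case: (ltngtP j i) => ij.
- have h : (j.+1%:R <= i%:R :> R) by rewrite ler_nat.
  by rewrite !ramp_ge1 ?subrr //; rewrite -!natr1 in h *; lra.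
- have h : (i.+1%:R <= j%:R :> R) by rewrite ler_nat.
  by rewrite !ramp_le0 ?subrr //; rewrite -!natr1 in h *; lra.
- by rewrite ij subrr (ramp_le0 (lexx _)) subr0 ramp_ge1 // -natr1; lra.
Qed.

Lemma interp_nat (i : nat) : interp i%:R = (J i)%:R.
Proof.
elim: i => [|i IH].
  rewrite /interp big1 => [|j _]; last first.
    by rewrite ramp_le0 ?mulr0 // sub0r oppr_le0 ler0n.
  by rewrite max_r ?addr0 // sub0r oppr_le0 ler0n.
have -> : (J i.+1)%:R = (J i)%:R + (J i.+1 - J i)%:R :> R.
  by rewrite natrB // addrC subrK.
rewrite -IH /interp.
set S := \sum_(_ < L) _; set T := \sum_(_ < L) _.
have ST : S - T = \sum_(j < L) (J j.+1 - J j)%:R * (val j == i)%:R.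
  by rewrite -sumrB; apply: eq_bigr => j _; rewrite -mulrBr ramp_natS.
suff : S - T + (Num.max (i.+1%:R - L%:R) 0 - Num.max (i%:R - L%:R) 0)
       = (J i.+1 - J i)%:R :> R by lra.
rewrite ST; case: (ltnP i L) => iL.
  rewrite (bigD1 (Ordinal iL)) //= eqxx mulr1 big1 => [|j]; last first.
    by rewrite -val_eqE /= => /negbTE ->; rewrite mulr0.
  rewrite !max_r ?subr_le0 ?ler_nat //; last exact: ltnW.
  by rewrite subrr !addr0.
rewrite big1 => [|j _]; last first.
  by rewrite ltn_eqF ?mulr0 // (leq_trans (ltn_ord j)).
rewrite !max_l ?subr_ge0 ?ler_nat //; last exact: leqW.
rewrite J_tail // subSn // subnn -!natr1; lra.
Qed.

Lemma interp_ge0 s : 0 <= interp s.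
Proof.
rewrite /interp !addr_ge0 ?ler0n // ?le_max ?lexx ?orbT //.
by apply: sumr_ge0 => j _; rewrite mulr_ge0 ?ler0n ?ramp_ge0.
Qed.

Lemma interp_ge s : s - L%:R <= interp s.
Proof.
have h : s - L%:R <= Num.max (s - L%:R) 0 by rewrite le_max lexx.
apply: (le_trans h); rewrite /interp lerDr addr_ge0 ?ler0n //.
by apply: sumr_ge0 => j _; rewrite mulr_ge0 ?ler0n ?ramp_ge0.
Qed.

Lemma interp_continuous : continuous interp.
Proof.
have sub_cont (c : R) : continuous (fun s : R => s - c).
  by move=> s; apply: (@cvgB _ R^o); [exact: cvg_id | exact: cvg_cst].
have max0_cont (f : R -> R) : continuous f ->
    continuous (fun s => Num.max (f s) 0).
  by move=> cf s; apply: continuous_max; [exact: cf | exact: cvg_cst].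
have min1_cont (f : R -> R) : continuous f ->
    continuous (fun s => Num.min (f s) 1).
  by move=> cf s; apply: continuous_min; [exact: cf | exact: cvg_cst].
have sum_cont (r : seq 'I_L) : continuous
    (fun s : R => \sum_(j <- r) (J j.+1 - J j)%:R * ramp (s - j%:R)).
  elim: r => [|j r IH] s; first by under eq_fun do rewrite big_nil; exact: cvg_cst.
  under eq_fun do rewrite big_cons; apply: (@cvgD _ R^o); last exact: IH.
  apply: (@cvgM R); first exact: cvg_cst.
  exact: (min1_cont _ (max0_cont _ (sub_cont _))).
move=> s; apply: (@cvgD _ R^o); last exact: (max0_cont _ (sub_cont _)).
by apply: (@cvgD _ R^o); [exact: cvg_cst | exact: sum_cont].
Qed.

Lemma interp_proper (C : set R) :
  compact C -> compact ([set s | 0 <= s] `&` interp @^-1` C).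
Proof.
move=> cC; have [B [_ hB]] := @compact_bounded R R^o _ cC.
(* [compact_bounded] bounds [C] by every real above [B], so by [B + 1]. *)
have hC x : C x -> `|x| <= B + 1 by apply: hB; rewrite ltrDl ltr01.
apply: (@subclosed_compact _ _ `[0, B + 1 + L%:R]); last 1 first.
- move=> s /= [s0 /hC]; rewrite in_itv /= s0 /= ger0_norm ?interp_ge0 //.
  by have := interp_ge s; lra.
- apply: closedI; first exact: closed_ge.
  apply: preimage_closed; last exact: (compact_closed (@Rhausdorff _) cC).
  by move=> s _; exact: interp_continuous.
- exact: segment_compact.
Qed.

End PiecewiseLinear.

(** * Matching the vertices of two paths in the Cayley graph *)

Section FellowTravel.
Variables (gen : finType) (rels : seq (word gen)).
Implicit Types (w u g h : word gen).

(** The index [i] is the integer part of [s]; past the end of the path, [take i w] is all of [w]. *)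
Lemma pt_on_end w s P : 0 <= s -> pt_on w s P ->
  exists i d, [/\ i%:R <= s < i.+1%:R, d <= 1 & is_end P (take i w) d].
Proof.
move=> s0 [[i [x [r [_ [is_ [si ->]]]]]] | [ws ->]].
  exists i, (s - i%:R); split; [by rewrite is_ | | by left].
  by move: si; rewrite -natr1; lra.
exists (Num.truncn s), 0; rewrite truncn_itv // ler01; split => //.
by rewrite take_oversize // truncn_ge_nat.
Qed.

Lemma eqG_cat2l p u v : eqG rels u v -> eqG rels (p ++ u) (p ++ v).
Proof.
elim=> {u v} [w|w u _ /eqG_sym//|w u v _ + _|u v x|u v r hr].
- exact: eqG_refl.
- exact: eqG_trans.
- by rewrite !catA; exact: eqG_free.
- by rewrite (catA p u v) (catA p u); exact: eqG_rel.
Qed.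

Lemma eqG_cat2r p u v : eqG rels u v -> eqG rels (u ++ p) (v ++ p).
Proof.
elim=> {u v} [w|w u _ /eqG_sym//|w u v _ + _|u v x|u v r hr].
- exact: eqG_refl.
- exact: eqG_trans.
- by rewrite -!catA; exact: eqG_free.
- by rewrite -!catA; exact: eqG_rel.
Qed.

Lemma eqG_cat u u' v v' :
  eqG rels u u' -> eqG rels v v' -> eqG rels (u ++ v) (u' ++ v').
Proof.
move=> /(eqG_cat2r v) uu' /(eqG_cat2l u'); exact: eqG_trans.
Qed.

Lemma vdist_le_cat g h (n : nat) v m : vdist_le rels g h n -> (size v <= m)%N ->
  vdist_le rels g (h ++ v) (n + m).
Proof.
move=> [p [pn gph]] vm; exists (p ++ v); rewrite size_cat leq_add //.
by split => //; rewrite catA; exact: eqG_cat2r.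
Qed.

(** For [s] in [[i, i+1)] the point of [u] lies at most 1 past a vertex of index between [J i] and
    [J i.+1], hence at most [C] letters after [J i]. The offsets of the two points from their
    vertices account for the final 2. *)
Lemma async_fellow_travel_discrete (J : nat -> nat) (L C M : nat) w u :
  (forall i, (J i <= J i.+1 <= J i + C)%N) ->
  (forall i, (L <= i)%N -> J i.+1 = (J i).+1) ->
  (forall i, vdist_le rels (take i w) (take (J i) u) M) ->
  async_fellow_travel rels (M + C).+2%:R w u.
Proof.
move=> Jhomo Jtail Jdist.
have J_le i : (J i <= J i.+1)%N by case/andP: (Jhomo i).
exists (interp J L); split; first by move=> s _; exact: interp_ge0.
split; first by move=> s t _; exact: interp_homo.
split; first by apply: continuous_subspaceT; exact: interp_continuous.
split; first exact: interp_proper.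
move=> s s0 P Q /(pt_on_end s0) [i [d [/andP[is_ si] d1 Pend]]].
move=> /(pt_on_end (interp_ge0 _ _ _)) [j [e [/andP[js sj] e1 Qend]]].
have := interp_homo J L is_; rewrite interp_nat // => Js.
have := interp_homo J L (ltW si); rewrite interp_nat // => sJ.
have Jj : (J i <= j)%N by rewrite -ltnS -(ltr_nat R); lra.
have jJ : (j <= J i.+1)%N by rewrite -(ler_nat R); lra.
right; exists (take i w), d, (take j u), e, (M + C)%N; split => //; split => //.
split; last by rewrite -addn2 natrD; lra.
rewrite -(subnKC Jj) takeD; apply: vdist_le_cat => //.
rewrite size_take_min geq_min leq_subLR; apply/orP; left.
by apply: leq_trans jJ _; case/andP: (Jhomo i).
Qed.

(* Discrete fellow travelling of the paths [w] from [g] and [u] from [h]: each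
   letter of [w] is matched with a block of at most [C] letters of [u]. *)
Inductive travels (C M : nat) :
    word gen -> word gen -> word gen -> word gen -> Prop :=
| travels_nil g h u : vdist_le rels g h M -> (size u <= C)%N ->
    travels C M g h [::] u
| travels_cons g h x w u v : vdist_le rels g h M -> (size u <= C)%N ->
    travels C M (g ++ [:: x]) (h ++ u) w v -> travels C M g h (x :: w) (u ++ v).

(** [J i] counts the letters of [u] in the first [i] blocks and grows with slope 1 after the end of
    [w]. The last block of [u] is matched with no letter of [w]; this costs the extra [C] in the
    distance. *)
Lemma travels_index C M g h w u : (0 < C)%N -> travels C M g h w u ->
  exists J : nat -> nat,
    [/\ J 0 = 0, forall i, (J i <= J i.+1 <= J i + C)%N,
        forall i, (size w <= i)%N -> J i.+1 = (J i).+1 &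
        forall i, vdist_le rels (g ++ take i w) (h ++ take (J i) u) (M + C)]%N.
Proof.
move=> C0; elim=> {g h w u} [g h u gh uC | g h x w u v gh uC _].
  exists id; split=> // [i|i]; first by rewrite leqnSn -addn1 leq_add2l.
  rewrite cats0; apply: vdist_le_cat => //.
  by rewrite size_take_min geq_min uC orbT.
case=> J [J0 Jhomo Jtail Jdist].
exists (fun i => if i is i'.+1 then size u + J i' else 0)%N; split=> //.
- by case=> [|i]; rewrite ?J0 ?addn0 // -addnA !leq_add2l.
- by case=> // i iw; rewrite Jtail // addnS.
case=> [|i]; first by rewrite !take0 !cats0 -[h]cats0; apply: vdist_le_cat.
by rewrite take_cat ltnNge leq_addr /= addKn -cat1s !catA.
Qed.

(** The reparametrization starts at [size u0], so the paths are compared from the end of [u0] on. *)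
Lemma async_fellow_travel_travels C M u0 w u : (0 < C)%N ->
  travels C M [::] u0 w u -> async_fellow_travel rels (M + C + C).+2%:R w (u0 ++ u).
Proof.
move=> C0 /(travels_index C0) [J [_ Jhomo Jtail Jdist]].
apply: (@async_fellow_travel_discrete (fun i => size u0 + J i)%N (size w)).
- by move=> i; rewrite -addnA !leq_add2l.
- by move=> i iw; rewrite Jtail // addnS.
by move=> i; rewrite take_cat ltnNge leq_addr /= addKn; exact: Jdist.
Qed.

End FellowTravel.

(** * Words and free reduction *)

Definition sg (s : bool) : int := if s then -1 else 1.

Section Words.
Variable gen : finType.
Implicit Types (x y : letter gen) (v w : word gen) (z : int) (g : gen).

(** The condition [0 <= sg s * z] says that the new letter does not cancel against the power;
    [pow_letter_ind] uses it to move away from 0 in both directions. *)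
Lemma pow_letter_cons g z s : 0 <= sg s * z ->
  pow_letter g (z + sg s) = (g, s) :: pow_letter g z.
Proof.
case: s z => [] [m|m] //=; rewrite ?mulN1r ?mul1r //.
- by case: m => // m; rewrite oppr_ge0.
- by rewrite addn0.
- by rewrite addn1.
Qed.

Lemma pow_letter_ind (P : int -> Prop) : P 0 ->
  (forall z s, 0 <= sg s * z -> P z -> P (z + sg s)) -> forall z, P z.
Proof.
move=> P0 PS [m|m].
  elim: m => // m IH; have -> : Posz m.+1 = Posz m + sg false by rewrite /sg /=; lia.
  by apply: PS => //; rewrite /sg /=; lia.
elim: m => [|m IH].
  have -> : Negz 0 = 0 + sg true by [].
  by apply: PS.
have -> : Negz m.+1 = Negz m + sg true by rewrite /sg /=; lia.
by apply: PS => //; rewrite /sg /=; lia.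
Qed.

Lemma size_pow_letter g z : size (pow_letter g z) = `|z|%N.
Proof. by case: z => m /=; rewrite size_nseq. Qed.

Definition reduced : rel (letter gen) := fun x y => y != inv_letter x.

Lemma inv_letterK : involutive (@inv_letter gen).
Proof. by case=> g s; rewrite /inv_letter /= negbK. Qed.

Lemma path_reduced_pow_letter g s z v :
  path reduced (g, s) (pow_letter g z ++ v) -> 0 <= sg s * z.
Proof.
case: s z => [] [[|m]|m] //=; rewrite /reduced /inv_letter /= ?eqxx //.
Qed.

Lemma sorted_pow_letter_cat g z v :
  sorted reduced v -> (if v is y :: _ then y.1 != g else true) ->
  sorted reduced (pow_letter g z ++ v).
Proof.
move=> v_red v_g; elim/pow_letter_ind: z => [|z s sz IH] //.
rewrite pow_letter_cons //=.
case E : (pow_letter g z ++ v) IH => [|y p] //= ->; rewrite andbT.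
case: z sz E => [[|m]|m] /=; case: s => //=.
- by move=> _ E; move: v_g; rewrite E; apply: contraNneq => ->.
- by move=> _ E; move: v_g; rewrite E; apply: contraNneq => ->.
- by move=> _ [<- _]; rewrite /reduced /inv_letter xpair_eqE eqxx.
- by move=> _ [<- _]; rewrite /reduced /inv_letter xpair_eqE eqxx.
Qed.

(** Left multiplication by a letter in the free group, on reduced words. *)
Definition push x v := if v is y :: v' then
  if y == inv_letter x then v' else x :: v else [:: x].

Lemma push_sorted x v : sorted reduced v -> sorted reduced (push x v).
Proof.
case: v => [|y v] //= pv; case: ifP => [_|/negbT yx]; first exact: path_sorted pv.
by rewrite /= pv andbT.
Qed.

Lemma push_path x v : path reduced x v -> push x v = x :: v.
Proof. by case: v => [|y v] //= /andP[/negbTE -> _]. Qed.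

Lemma pushK x v : sorted reduced v -> push x (push (inv_letter x) v) = v.
Proof.
case: v => [|y v] /=; first by rewrite eqxx.
rewrite inv_letterK; case: eqP => [-> /push_path //|_ _].
by rewrite /= eqxx.
Qed.

Definition pushes p v := foldr push v p.

Lemma pushes_sorted p v : sorted reduced v -> sorted reduced (pushes p v).
Proof. by move=> v_red; elim: p => //= x p IH; exact: push_sorted. Qed.

Lemma push_pow_letter g s z v : sorted reduced v ->
  push (g, s) (pushes (pow_letter g z) v) = pushes (pow_letter g (z + sg s)) v.
Proof.
move=> v_red; have [sz|sz] := lerP 0 (sg s * z); first by rewrite pow_letter_cons.
(* For opposite signs the power begins with the inverse letter, which [pushK] cancels. *)
have -> : z = (z + sg s) + sg (~~ s) by case: s {sz} => /=; lia.
rewrite pow_letter_cons /=; last by case: s sz => /=; lia.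
rewrite (pushK (g, s)) ?pushes_sorted //.
by congr (pushes (pow_letter _ _) _); case: s {sz} => /=; lia.
Qed.

Lemma pushes_pow_letterD g z z' v : sorted reduced v ->
  pushes (pow_letter g z) (pushes (pow_letter g z') v) =
  pushes (pow_letter g (z + z')) v.
Proof.
move=> v_red; elim/pow_letter_ind: z => [|z s sz IH]; first by rewrite add0r.
by rewrite pow_letter_cons //= IH push_pow_letter // addrAC.
Qed.

(** The automaton remembers the last letter read: [Some None] is the state before any letter, [None]
    the failure state. *)
Lemma sorted_dfa (r : rel (letter gen)) :
  exists D : dfa gen, forall w, accepts D w = sorted r w.
Proof.
pose tr (st : option (option (letter gen))) x := match st with
  | None => None
  | Some None => Some (Some x)
  | Some (Some y) => if r y x then Some (Some x) else None
  end.
exists (@Dfa gen (option (option (letter gen))) (Some None) isSome tr).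
case=> //= x w; rewrite /accepts /=.
elim: w x => //= y w IH x; case: ifP => // _.
by elim: w {IH}.
Qed.

Variable rels : seq (word gen).
Local Notation "u ~~~ v" := (eqG rels u v) (at level 70).

Lemma eqG_pow_letter_cons g s z :
  [:: (g, s)] ++ pow_letter g z ~~~ pow_letter g (z + sg s).
Proof.
have [sz|sz] := lerP 0 (sg s * z).
  by rewrite pow_letter_cons //; exact: eqG_refl.
have -> : z = (z + sg s) + sg (~~ s) by case: s {sz} => /=; lia.
rewrite pow_letter_cons /=; last by case: s sz => /=; lia.
have -> : z + sg s + sg (~~ s) + sg s = z + sg s by case: s {sz} => /=; lia.
exact: (eqG_free rels [::] _ (g, s)).
Qed.

Lemma eqG_pow_letterD g z z' :
  pow_letter g z ++ pow_letter g z' ~~~ pow_letter g (z + z').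
Proof.
elim/pow_letter_ind: z => [|z s sz IH]; first by rewrite add0r; exact: eqG_refl.
rewrite pow_letter_cons // cat_cons -cat1s addrAC.
apply: eqG_trans (eqG_pow_letter_cons _ _ _); exact: eqG_cat2l.
Qed.

End Words.

(** * Moving [t] through a reduced word *)

Section EqG.
Variables (gen : finType) (rels : seq (word gen)).
Local Notation "u ~~~ v" := (eqG rels u v) (at level 70).

#[global] Instance eqG_equivalence : RelationClasses.Equivalence (eqG rels).
Proof.
by split=> [w|w u|w u v]; [exact: eqG_refl | exact: eqG_sym | exact: eqG_trans].
Qed.

#[global] Instance cat_eqG :
  Morphisms.Proper
    (Morphisms.respectful (eqG rels) (Morphisms.respectful (eqG rels) (eqG rels)))
    (@cat (letter gen)).
Proof. by move=> u u' uu' v v' vv'; exact: eqG_cat. Qed.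

#[local] Hint Resolve eqG_refl : core.

#[global] Instance cons_eqG (x : letter gen) :
  Morphisms.Proper (Morphisms.respectful (eqG rels) (eqG rels)) (cons x).
Proof. by move=> u v /(eqG_cat2l [:: x]). Qed.

Lemma eqG_mulVK g s w : (g, s) :: (g, ~~ s) :: w ~~~ w.
Proof. exact: (eqG_free rels [::] w (g, s)). Qed.

Lemma eqG_relator r : r \in rels -> r ~~~ [::].
Proof. by move=> /(eqG_rel [::] [::]); rewrite cats0. Qed.

Lemma eqG_mulgI x u v : x :: u ~~~ x :: v -> u ~~~ v.
Proof.
case: x => g s /(eqG_cat2l [:: (g, ~~ s)]) /=.
by rewrite -{2 4}[s]negbK; setoid_rewrite eqG_mulVK.
Qed.

Lemma eqG_mulIg g s u v : u ++ [:: (g, s)] ~~~ v ++ [:: (g, s)] -> u ~~~ v.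
Proof.
move=> /(eqG_cat2r [:: (g, ~~ s)]); rewrite -!catA /=.
by setoid_rewrite eqG_mulVK; rewrite !cats0.
Qed.

End EqG.

(** * Commutation with [t] and its effect on reduced words *)

Section Group.
Variables (k : nat) (n : 'I_k -> int).
Local Notation gen := 'I_k.+2.
Local Notation a := (gen_a k).
Local Notation t := (gen_t k).
Local Notation "u ~~~ v" := (eqG (G_rels n) u v) (at level 70).
Implicit Types (x y : letter gen) (v w : word gen) (d : int) (s : bool).

#[local] Hint Resolve eqG_refl : core.

Lemma gen_a_neq_t : a != t.
Proof. by rewrite -val_eqE /= !inordK. Qed.

Lemma val_gen_b (i : 'I_k) : val (gen_b i) = i.+2.
Proof. by rewrite /= inordK // !ltnS. Qed.

Lemma gen_b_neq_a i : gen_b i != a.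
Proof. by rewrite -val_eqE val_gen_b /= inordK. Qed.

Lemma gen_b_neq_t i : gen_b i != t.
Proof. by rewrite -val_eqE val_gen_b /= inordK. Qed.

Lemma gen_b_inj : injective (@gen_b k).
Proof. by move=> i j /(congr1 val); rewrite !val_gen_b => -[] /val_inj. Qed.

Lemma genP (g : gen) : g != a -> g != t -> exists i, g = gen_b i.
Proof.
case: g => -[|[|m]] ltm; rewrite -!val_eqE /= !inordK // => _ _.
by exists (Ordinal (ltm : (m < k)%N)); apply: val_inj; rewrite val_gen_b.
Qed.

(* The exponents [n_i], extended by 0 to [a] and [t]. *)
Definition expo (g : gen) : int := \sum_(i | gen_b i == g) n i.

Lemma expo_b i : expo (gen_b i) = n i.
Proof.
rewrite /expo (big_pred1 i) // => j; apply/eqP/eqP => [/gen_b_inj //|-> //].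
Qed.

Lemma expo_a : expo a = 0.
Proof. by rewrite /expo big_pred0 // => i; exact/negbTE/gen_b_neq_a. Qed.

Lemma eqG_at s s' w : (a, s) :: (t, s') :: w ~~~ (t, s') :: (a, s) :: w.
Proof.
suff at_ : [:: (a, s); (t, s')] ~~~ [:: (t, s'); (a, s)].
  exact: (eqG_cat2r w at_).
have base : [:: (a, false); (t, false)] ~~~ [:: (t, false); (a, false)].
  apply: (@eqG_mulIg _ _ a true) => /=; setoid_rewrite (eqG_mulVK _ a false).
  apply: (@eqG_mulIg _ _ t true) => /=; setoid_rewrite (eqG_mulVK _ t false).
  by apply: eqG_relator; rewrite inE eqxx.
(* Multiplying by a letter on both sides turns commutation with it into commutation with its
   inverse. *)
have at1 : [:: (a, s); (t, false)] ~~~ [:: (t, false); (a, s)].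
  case: s => //; apply: (@eqG_mulgI _ _ (a, false)).
  setoid_rewrite (eqG_mulVK _ a false).
  apply: (@eqG_mulIg _ _ a false) => /=; setoid_rewrite (eqG_mulVK _ a true).
  by symmetry.
case: s' => //; apply: (@eqG_mulgI _ _ (t, false)).
setoid_rewrite (eqG_mulVK _ t false).
apply: (@eqG_mulIg _ _ t false) => /=; setoid_rewrite (eqG_mulVK _ t true).
by symmetry.
Qed.

Lemma eqG_pow_t d s w :
  pow_letter a d ++ (t, s) :: w ~~~ (t, s) :: pow_letter a d ++ w.
Proof.
elim/pow_letter_ind: d => [|d s' sd IH] //=.
by rewrite pow_letter_cons //=; setoid_rewrite IH; setoid_rewrite eqG_at.
Qed.

Lemma eqG_powD d d' w :
  pow_letter a d ++ pow_letter a d' ++ w ~~~ pow_letter a (d + d') ++ w.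
Proof. by rewrite catA; apply: eqG_cat2r; exact: eqG_pow_letterD. Qed.

Lemma eqG_pow_cons d s w :
  pow_letter a d ++ (a, s) :: w ~~~ pow_letter a (d + sg s) ++ w.
Proof. by have := eqG_powD d (sg s) w; case: s. Qed.

(** The relator says [t b = b a^n t]; since [a] and [t] commute, [b t = t b a^(-n)]. *)
Lemma eqG_bt i s w : (gen_b i, false) :: (t, s) :: w ~~~
  (t, s) :: (gen_b i, false) :: pow_letter a (- (sg s * n i)) ++ w.
Proof.
have bt w' : (gen_b i, false) :: (t, false) :: w' ~~~
    (t, false) :: (gen_b i, false) :: pow_letter a (- n i) ++ w'.
  suff bt : [:: (gen_b i, false); (t, false)] ~~~
      (t, false) :: (gen_b i, false) :: pow_letter a (- n i).
    exact: (eqG_cat2r w' bt).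
  apply: (@eqG_mulgI _ _ (gen_b i, true)); setoid_rewrite (eqG_mulVK _ _ true).
  apply: (@eqG_mulIg _ _ t true) => /=; setoid_rewrite (eqG_mulVK _ _ false).
  setoid_rewrite eqG_pow_t; rewrite cats0; symmetry.
  apply: eqG_relator; rewrite inE; apply/orP; right.
  by apply/mapP; exists i; rewrite ?mem_enum.
case: s; last by rewrite mul1r.
rewrite mulN1r opprK; apply: (@eqG_mulgI _ _ (t, false)).
setoid_rewrite (eqG_mulVK _ t false).
(* The factor [a^(n_i)] is inserted to cancel the power that the positive case produces. *)
have := bt (pow_letter a (n i) ++ (t, true) :: w).
setoid_rewrite eqG_powD; rewrite addNr /= => <-.
by setoid_rewrite eqG_pow_t; setoid_rewrite (eqG_mulVK _ t false).
Qed.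

(* [shift_in s x] and [shift_out s x] are the exponents for which
   [x t^s = t^s a^(- shift_in s x) x a^(shift_out s x)] for a letter [x] other
   than [t] and [t^-1], where [t^s] is [t] or [t^-1]. *)
Definition shift_in s x : int := if x.2 then - (sg s * expo x.1) else 0.
Definition shift_out s x : int := if x.2 then 0 else - (sg s * expo x.1).

Lemma eqG_letter_t s x w : x.1 != t -> x :: (t, s) :: w ~~~
  (t, s) :: pow_letter a (- shift_in s x) ++ x :: pow_letter a (shift_out s x) ++ w.
Proof.
case: x => g s' /= gt; rewrite /shift_in /shift_out /=.
have [->|ga] := eqVneq g a.
  by rewrite expo_a mulr0 oppr0; case: s'; exact: eqG_at.
have [i ->] := genP ga gt; rewrite expo_b.
case: s' => //=; last exact: eqG_bt.
rewrite opprK; apply: (@eqG_mulgI _ _ (gen_b i, false)).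
setoid_rewrite (eqG_mulVK _ _ false); setoid_rewrite eqG_bt.
setoid_rewrite eqG_powD; rewrite addNr /=.
by setoid_rewrite (eqG_mulVK _ _ false).
Qed.

(* The reduced form of [a^d v'], where [v t^s = t^s v']. *)
Fixpoint twist s d v : word gen :=
  if v is x :: v' then
    if x.1 == a then twist s (d + sg x.2) v'
    else pow_letter a (d - shift_in s x) ++ x :: twist s (shift_out s x) v'
  else pow_letter a d.

(** The invariant of [twist]: after reading [g] and writing [h], with [a^d] pending,
    [g t^s = h a^d]. *)
Lemma eqG_twist_step s d x g h : x.1 != t ->
  g ++ [:: (t, s)] ~~~ h ++ pow_letter a d ->
  (g ++ [:: x]) ++ [:: (t, s)] ~~~
  (h ++ pow_letter a (d - shift_in s x) ++ [:: x]) ++ pow_letter a (shift_out s x).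
Proof.
move=> xt gh; rewrite -catA /=; setoid_rewrite (eqG_letter_t _ _ xt).
rewrite -cat1s catA; setoid_rewrite gh; rewrite -!catA.
by setoid_rewrite eqG_powD; rewrite cats0.
Qed.

Lemma eqG_twist s d v g h : all (fun x => x.1 != t) v ->
  g ++ [:: (t, s)] ~~~ h ++ pow_letter a d ->
  g ++ v ++ [:: (t, s)] ~~~ h ++ twist s d v.
Proof.
elim: v d g h => [|x v IH] d g h //= /andP[xt vt] gh.
have -> : g ++ x :: v ++ [:: (t, s)] = (g ++ [:: x]) ++ v ++ [:: (t, s)].
  by rewrite -catA.
case: eqP => xa.
  apply: IH => //.
  have := eqG_twist_step xt gh.
  rewrite /shift_in /shift_out xa expo_a mulr0 oppr0 !if_same subr0 cats0 => ->.
  by case: x xa {xt} => _ s' /= ->; setoid_rewrite eqG_pow_cons; rewrite cats0.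
have := IH _ _ _ vt (eqG_twist_step xt gh).
by rewrite -!catA.
Qed.

Lemma twist_all s d v : all (fun x => x.1 != t) v ->
  all (fun x => x.1 != t) (twist s d v).
Proof.
have pt d' : all (fun x => x.1 != t) (pow_letter a d').
  by case: d' => m; rewrite all_nseq /= gen_a_neq_t ?orbT.
elim: v d => [|x v IH] d //= /andP[xt vt].
by case: ifP => _; rewrite ?IH // all_cat pt /= xt IH.
Qed.

(** No power of [a] is written before [y] only if the leading power of [a] in [v] and the pending
    exponent together make up [shift_in s y]. *)
Lemma twist_head s d v y u : y.1 != a -> sorted (@reduced _) v ->
  twist s d v = y :: u ->
  exists z v', v = pow_letter a z ++ y :: v' /\ d + z = shift_in s y.
Proof.
move=> ya; elim: v d => [|x v IH] d /=.
  by case: d => [[|m]|m] //= _ [ey _]; rewrite -ey eqxx in ya.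
case: eqP => xa xv.
  move=> /(IH _ (path_sorted xv)) [z [v' [vE dz]]].
  exists (z + sg x.2), v'; split; last by rewrite -dz addrA addrAC.
  case: x xa xv {dz} => _ s' /= ->; rewrite vE => /path_reduced_pow_letter sz.
  by rewrite pow_letter_cons.
case dx : (d - shift_in s x) => [[|m]|m] /=;
  try by case=> ey _; rewrite -ey eqxx in ya.
by case=> <- _; exists 0, v; split => //; lia.
Qed.

(** The danger is a letter [x] whose inverse comes next in the output. As [shift_in] of the inverse
    equals [shift_out] of [x], [twist_head] gives [z = 0]: the two letters were already adjacent in
    the input, which is reduced. *)
Lemma twist_sorted s d v : sorted (@reduced _) v -> sorted (@reduced _) (twist s d v).
Proof.
elim: v d => [|x v IH] d /=.
  by move=> _; rewrite -[pow_letter _ _]cats0; exact: sorted_pow_letter_cat.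
move=> xv; have v_red := path_sorted xv.
case: eqP => [_|/eqP xa]; first exact: IH.
apply: sorted_pow_letter_cat => //=.
have := IH (shift_out s x) v_red.
case E : (twist _ _ _) => [|y u] //= ->; rewrite andbT.
apply/eqP => yE; have ya : y.1 != a by rewrite yE.
have [z [v' [vE]]] := twist_head ya v_red E.
have -> : shift_in s y = shift_out s x by rewrite yE /shift_in /shift_out /=; case: (x.2).
move=> dz; have z0 : z = 0 by lia.
by move: xv; rewrite vE z0 /= yE /reduced eqxx.
Qed.

(* All [b]-letters shift by at most [N]: once the pending exponent is at least
   [N], further letters [a^s] are really output. *)
Lemma twist_cons (N : nat) s s' d v : (forall x, `|shift_in s x| <= N%:Z) ->
  path (@reduced _) (a, s') v -> N%:Z <= sg s' * d ->
  twist s (d + sg s') v = (a, s') :: twist s d v.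
Proof.
move=> hN; elim: v d => [|x v IH] d /=.
  by move=> _ Nd; rewrite pow_letter_cons //; lia.
move=> /andP[s'x xv] Nd; case: eqP => xa.
  have xs' : x = (a, s').
    case: x xa s'x {xv} => _ s'' /= ->; rewrite /reduced /inv_letter /= xpair_eqE.
    by rewrite eqxx /=; case: s' {IH Nd} s'' => -[].
  rewrite xs' in xv *; apply: IH => //.
  by case: (s') Nd => /=; lia.
rewrite addrAC pow_letter_cons //.
by have := hN x; case: (s') Nd => /=; lia.
Qed.

End Group.

(** * Paths that differ only at their end *)

Section Prefixes.
Variables (gen : finType) (rels : seq (word gen)) (C M : nat).

Lemma vdist_le_refl g m : vdist_le rels g g m.
Proof. by exists [::]; rewrite cats0; split=> //; exact: eqG_refl. Qed.

Lemma travels_catr g w v : (size v <= C)%N -> (0 < C)%N ->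
  travels rels C M g g w (w ++ v).
Proof.
move=> vC C0; elim: w g => [|x w IH] g.
  by apply: travels_nil => //; exact: vdist_le_refl.
by apply: (travels_cons (u := [:: x])) => //; exact: vdist_le_refl.
Qed.

Lemma travels_catl g w x : (0 < C)%N -> (0 < M)%N ->
  travels rels C M g g (w ++ [:: x]) w.
Proof.
move=> C0 M0; elim: w g => [|y w IH] g /=.
  apply: (travels_cons (u := [::]) (v := [::])) => //; first exact: vdist_le_refl.
  apply: travels_nil => //; exists [:: inv_letter x]; split => //.
  by rewrite -catA; exact: eqG_free.
by apply: (travels_cons (u := [:: y])) => //; exact: vdist_le_refl.
Qed.

End Prefixes.

(** * Normal forms [t^z v] and their fellow travelling *)

Section NormalForms.
Variables (k : nat) (n : 'I_k -> int).
Local Notation gen := 'I_k.+2.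
Local Notation a := (gen_a k).
Local Notation t := (gen_t k).
Local Notation "u ~~~ v" := (eqG (G_rels n) u v) (at level 70).
Local Notation tfree := (all (fun x => x.1 != t)).
Implicit Types (x y : letter gen) (v w : word gen) (d z : int) (s : bool).

#[local] Hint Resolve eqG_refl : core.

Definition maxexpo : nat := \max_(g : gen) `|expo n g|%N.
Local Notation N := maxexpo.
Local Notation C := (N + N).+1.
Local Notation M := N.+1.

Lemma expo_le g : (`|expo n g| <= N)%N.
Proof. exact: (@leq_bigmax _ (fun g => absz (expo n g))). Qed.

Lemma shift_in_le s x : `|shift_in n s x| <= N%:Z.
Proof.
rewrite /shift_in; have := expo_le x.1.
by case: (x.2); case: s => /=; lia.
Qed.

Lemma shift_out_le s x : `|shift_out n s x| <= N%:Z.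
Proof.
rewrite /shift_out; have := expo_le x.1.
by case: (x.2); case: s => /=; lia.
Qed.

(** The pending exponent stays in [[-N, N]]. Matched vertices thus differ by [t^s a^(-d)], of length
    at most [N + 1 = M], and a block consists of a letter and at most [N + N] letters [a] or [a^-1],
    whence [C]. *)
Lemma travels_twist s d v g h : sorted (@reduced _) v -> tfree v -> `|d| <= N%:Z ->
  g ++ [:: (t, s)] ~~~ h ++ pow_letter a d ->
  travels (G_rels n) C M g h v (twist n s d v).
Proof.
move=> + + + gh.
have gh_le d' g' h' : `|d'| <= N%:Z -> g' ++ [:: (t, s)] ~~~ h' ++ pow_letter a d' ->
    vdist_le (G_rels n) g' h' M.
  move=> dN gh'; exists ((t, s) :: pow_letter a (- d')).
  split; first by rewrite /= size_pow_letter; lia.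
  rewrite -cat1s catA; setoid_rewrite gh'; rewrite -catA.
  by setoid_rewrite eqG_pow_letterD; rewrite subrr cats0.
elim: v d g h gh => [|x v IH] d g h gh.
  move=> _ _ dN; apply: travels_nil; first exact: gh_le gh.
  by rewrite size_pow_letter; lia.
move=> xv /= /andP[xt vt] dN; have v_red := path_sorted xv.
have gh_dist := gh_le _ _ _ dN gh.
have step := eqG_twist_step xt gh.
case: eqP => xa; last first.
  rewrite -[x :: twist _ _ _ _]cat1s catA; apply: travels_cons => //.
    rewrite size_cat size_pow_letter /=.
    by have := shift_in_le s x; lia.
  by apply: IH => //; exact: shift_out_le.
case: x xa xt xv step => _ s' /= -> _ xv.
rewrite /shift_in /shift_out /= expo_a mulr0 oppr0 !if_same subr0 cats0 => step.
(* A letter [a] or its inverse is absorbed into the pending exponent as long as this stays in the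
   interval; otherwise it is written at once and [d] is kept. *)
have [dN'|dN'] := lerP `|d + sg s'| N%:Z.
  apply: (travels_cons (u := [::])) => //; apply: IH => //.
  rewrite cats0; apply: eqG_trans step _; apply: eqG_cat2l.
  by have := eqG_pow_cons n d s' [::]; rewrite cats0.
(* Leaving the interval forces [sg s' * d = N], as [twist_cons] requires. *)
rewrite (twist_cons (shift_in_le s)) //; last first.
  by case: (s') dN' => /=; lia.
apply: (travels_cons (u := [:: (a, s')])) => //; apply: IH => //.
apply: eqG_trans step _; rewrite -catA; apply: eqG_cat2l.
have := eqG_pow_cons n d s' [::]; rewrite cats0 => /eqG_trans; apply.
by rewrite addrC; apply: eqG_sym; rewrite addrC; exact: eqG_pow_letter_cons.
Qed.

(** Both paths read the same power of [t] in step and stay [t^s] apart, because powers of [t]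
    commute. *)
Lemma travels_pow_t s z v u :
  (forall g h, g ++ [:: (t, s)] ~~~ h -> travels (G_rels n) C M g h v u) ->
  forall g h, g ++ [:: (t, s)] ~~~ h ->
  travels (G_rels n) C M g h (pow_letter t z ++ v) (pow_letter t z ++ u).
Proof.
move=> vu; elim/pow_letter_ind: z => [|z s' sz IH] g h gh; first exact: vu.
rewrite pow_letter_cons //=; apply: (travels_cons (u := [:: (t, s')])) => //.
  by exists [:: (t, s)].
apply: IH; setoid_rewrite <- gh; rewrite -!catA; apply: eqG_cat2l.
case: (s') (s) => -[] //=.
  exact: eqG_trans (eqG_mulVK _ t true _) (eqG_sym (eqG_mulVK _ t false _)).
exact: eqG_trans (eqG_mulVK _ t false _) (eqG_sym (eqG_mulVK _ t true _)).
Qed.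

(** A condition on consecutive letters, as [sorted_dfa] needs, that characterizes the reduced words
    with all their [t]-letters in front. *)
Definition nf_step : rel (letter gen) :=
  fun x y => reduced x y && ((y.1 == t) ==> (x.1 == t)).

Lemma nfP w : sorted nf_step w ->
  exists z v, [/\ w = pow_letter t z ++ v, tfree v & sorted (@reduced _) v].
Proof.
elim: w => [|x w IH] /=; first by exists 0, [::].
move=> xw; have [z [v [wE vt v_red]]] := IH (path_sorted xw).
have xw_red : path (@reduced _) x w.
  by apply: sub_path xw => ? ? /andP[].
have [xt|xt] := eqVneq x.1 t.
  exists (z + sg x.2), v; split => //; rewrite wE.
  case: x xt xw_red {xw} => _ s /= ->; rewrite wE => /path_reduced_pow_letter sz.
  by rewrite pow_letter_cons.
exists 0, (x :: v); rewrite /= xt vt.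
have z0 : z = 0.
  case: z wE => [[|m]|m] //= wE; move: xw; rewrite wE /= /nf_step /= eqxx (negbTE xt).
    by rewrite andbF.
  by rewrite andbF.
by move: xw_red; rewrite wE z0.
Qed.

Lemma sorted_nf z v : tfree v -> sorted (@reduced _) v ->
  sorted nf_step (pow_letter t z ++ v).
Proof.
move=> vt v_red.
have : sorted (@reduced _) (pow_letter t z ++ v).
  by apply: sorted_pow_letter_cat => //; case: (v) vt => //= y ? /andP[].
elim/pow_letter_ind: z => [_|z s sz IH].
  elim: v vt v_red => // x v IH /= /andP[_ vt] xv.
  case: v vt xv IH => //= y v /andP[yt vt] /andP[xy yv] ->; rewrite ?yt //.
  by rewrite /nf_step xy (negbTE yt).
rewrite pow_letter_cons //= => sw; have := IH (path_sorted sw).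
case: (pow_letter t z ++ v) sw => //= y p /andP[sy _] ->.
by rewrite /nf_step sy eqxx implybT.
Qed.

(** The prefix [u0] leaves room for a new [t]-letter at the front, matched with no letter of [w]. *)
Definition nf_travels w u := exists u0 u1,
  [/\ u = u0 ++ u1 & travels (G_rels n) C M [::] u0 w u1].

Lemma nf_step_travels w y : sorted nf_step w ->
  exists u, [/\ sorted nf_step u, u ~~~ w ++ [:: y] & nf_travels w u].
Proof.
move=> w_nf; have [yt|yt] := eqVneq y.1 t.
  case: y yt => _ s /= ->.
  have [z [v [wE vt v_red]]] := nfP w_nf.
  exists (pow_letter t (z + sg s) ++ twist n s 0 v); split.
  - by apply: sorted_nf; [exact: twist_all | exact: twist_sorted].
  - rewrite wE -catA; apply: eqG_sym; apply: eqG_twist => //.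
    by rewrite cats0; have := eqG_pow_letterD (G_rels n) t z (sg s); case: (s).
  have tr g h : g ++ [:: (t, s)] ~~~ h ->
      travels (G_rels n) C M g h v (twist n s 0 v).
    by move=> gh; apply: travels_twist; rewrite ?normr0 ?cats0.
  (* If the power of [t] grows, its new first letter is taken as [u0]. *)
  have [sz|sz] := lerP 0 (sg s * z).
    exists [:: (t, s)], (pow_letter t z ++ twist n s 0 v).
    by rewrite pow_letter_cons // wE; split => //; exact: (travels_pow_t _ tr (eqG_refl _ _)).
  (* If it shrinks, the first letter of [w] is the inverse of [t^s] and is matched with the empty
     block. *)
  exists [::], (pow_letter t (z + sg s) ++ twist n s 0 v); split => //.
  have zE : z = z + sg s + sg (~~ s) by case: (s) => /=; lia.
  rewrite wE {1}zE pow_letter_cons; last by case: (s) sz => /=; lia.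
  apply: (travels_cons (u := [::])) => //.
    by exists [::]; split.
  apply: (travels_pow_t _ tr).
  by have := eqG_mulVK (G_rels n) t (~~ s) [::]; rewrite negbK; exact.
(* A letter other than [t] and its inverse is appended to [w] or cancels the last letter of [w]. *)
case/lastP: w w_nf => [|w x] w_nf.
  exists [:: y]; split => //; exists [::], [:: y]; split => //.
  exact: (travels_catr _ _ [::] [::]).
have [yx|yx] := eqVneq y (inv_letter x).
  exists w; split.
  - by move: w_nf; rewrite -cats1 => /cat_sorted2[].
  - by rewrite yx -cats1 -catA -[X in X ~~~ _]cats0; apply: eqG_sym; exact: eqG_free.
  by exists [::], w; split => //; rewrite -cats1; exact: travels_catl.
exists (rcons w x ++ [:: y]); split => //.
- case: w w_nf => [|x0 w] /=; first by rewrite /nf_step /reduced yx (negbTE yt).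
  rewrite rcons_path cat_path last_rcons /= rcons_path => ->.
  by rewrite /nf_step /reduced yx (negbTE yt).
by exists [::], (rcons w x ++ [:: y]); split => //; exact: travels_catr.
Qed.

Lemma nf_surj w : exists u, sorted nf_step u /\ u ~~~ w.
Proof.
elim/last_ind: w => [|w x [u [u_nf uw]]]; first by exists [::].
have [u' [u'_nf u'u _]] := nf_step_travels x u_nf.
exists u'; split => //; apply: eqG_trans u'u _.
by rewrite -cats1; exact: eqG_cat2r.
Qed.

(** * Uniqueness of normal forms *)

(* Left multiplication by [x] on the elements [t^q v], with [v] reduced:
   [b t^q v = t^q b a^(- q n_b) v]. *)
Definition act x (st : int * word gen) : int * word gen :=
  if x.1 == t then (st.1 + sg x.2, st.2)
  else (st.1, let z := st.1 * expo n x.1 in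
              if x.2 then pushes (pow_letter a z) (push x st.2)
              else push x (pushes (pow_letter a (- z)) st.2)).

Lemma act_sorted st w : sorted (@reduced _) st.2 -> sorted (@reduced _) (foldr act st w).2.
Proof.
move=> v_red; elim: w => //= x w IH; rewrite /act.
by case: ifP => //= _; case: ifP => _; rewrite ?push_sorted ?pushes_sorted ?push_sorted.
Qed.

Lemma actK x st : sorted (@reduced _) st.2 -> act x (act (inv_letter x) st) = st.
Proof.
case: x st => g s [q v] /= v_red; rewrite /act /=; case: (g == t) => /=.
  by congr (_, _); case: s => /=; lia.
congr (_, _); case: s => /=.
  have := pushK (g, true) (pushes_sorted (pow_letter a (- (q * expo n g))) v_red).
  by rewrite /inv_letter /= => ->; rewrite pushes_pow_letterD // subrr.
rewrite pushes_pow_letterD ?push_sorted // addNr /=.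
exact: (pushK (g, false)).
Qed.

Lemma act_pow z q v : foldr act (q, v) (pow_letter a z) = (q, pushes (pow_letter a z) v).
Proof.
elim/pow_letter_ind: z => [|z s sz IH] //.
rewrite pow_letter_cons //= IH /act /= (negbTE (gen_a_neq_t k)) expo_a mulr0 oppr0.
by case: (s).
Qed.

Lemma act_rel r st : r \in G_rels n -> sorted (@reduced _) st.2 -> foldr act st r = st.
Proof.
case: st => q v /= r_rel v_red; move: r_rel; rewrite inE => /orP[/eqP ->|].
  rewrite /= /act /= eqxx (negbTE (gen_a_neq_t k)) /= expo_a !mulr0 oppr0 /=.
  by congr (_, _); [lia | exact: (pushK (a, false))].
case/mapP => i _ ->; rewrite foldr_cat act_pow /= /act /= eqxx.
rewrite (negbTE (gen_b_neq_t i)) /= expo_b pushes_pow_letterD //.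
have := pushK (gen_b i, true) (pushes_sorted (pow_letter a
  (- ((q + -1) * n i) + - n i)) v_red).
rewrite /inv_letter /= => ->.
rewrite pushes_pow_letterD //.
congr (_, _); first by lia.
(* From right to left, the relator contributes the exponents [- n i], then [- (q - 1) * n i] from
   [b] acting after [t^-1], then [q * n i] from [b^-1]. *)
by rewrite (_ : _ + _ = 0) //; ring.
Qed.

(** Cancelling pairs and relators act trivially, so the action on reduced states depends only on the
    group element. *)
Lemma act_eqG w u st : w ~~~ u -> sorted (@reduced _) st.2 ->
  foldr act st w = foldr act st u.
Proof.
move=> wu v_red; elim: wu => {w u} //.
- by move=> w u v _ -> _ ->.
- by move=> u v x; rewrite !foldr_cat /= actK //; exact: act_sorted.
- by move=> u v r r_rel; rewrite !foldr_cat (act_rel r_rel) //; exact: act_sorted.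
Qed.

(** A normal form can be read off from its action on the identity [(0, [::])], so it is determined
    by the element. While the power of [t] is 0, no power of [a] arises. *)
Lemma act_nf z v : tfree v -> sorted (@reduced _) v ->
  foldr act (0, [::]) (pow_letter t z ++ v) = (z, v).
Proof.
move=> vt v_red; rewrite foldr_cat.
have -> : foldr act (0, [::]) v = (0, v).
  elim: v vt v_red => //= x v IH /andP[xt vt] xv.
  rewrite IH //; last exact: path_sorted xv.
  rewrite /act (negbTE xt) /= mul0r oppr0 /= push_path //.
  by case: (x.2).
elim/pow_letter_ind: z => [|z s sz IH] //.
by rewrite pow_letter_cons //= IH /act /= eqxx.
Qed.

Lemma nf_inj w u : sorted nf_step w -> sorted nf_step u -> w ~~~ u -> w = u.
Proof.
move=> /nfP [z [v [-> vt v_red]]] /nfP [z' [v' [-> v't v'_red]]].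
move=> /(@act_eqG _ _ (0, [::])) /(_ isT).
by rewrite !act_nf // => -[-> ->].
Qed.

End NormalForms.

Theorem mainTheorem1 (k : nat) (n : 'I_k -> int) (hk : (1 <= k)%N) :
  async_automatic (G_rels n).
Proof.
have [D acceptsE] := sorted_dfa (@nf_step k).
set N := maxexpo n; pose C := (N + N).+1.
(* The constant of [async_fellow_travel_travels] with [M = N + 1]. *)
exists D, (N.+1 + C + C).+2%:R; split.
  by move=> g; have [w [w_nf wg]] := nf_surj n g; exists w; rewrite acceptsE.
split.
  move=> g; have [u [u_nf ug]] := nf_surj n g; exists [:: u] => w.
  rewrite acceptsE inE => w_nf wg; apply/eqP; apply: (nf_inj w_nf u_nf).
  by apply: eqG_trans wg _; exact: eqG_sym.
move=> w u x; rewrite !acceptsE => w_nf u_nf uw.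
suff [u0 [u1 [-> tr]]] : nf_travels n w u by exact: async_fellow_travel_travels tr.
case: x uw => [y|] uw.
  have [u' [u'_nf u'w tr]] := nf_step_travels n y w_nf.
  (* By uniqueness [u] is the normal form just constructed from [w] and [y]. *)
  rewrite (nf_inj (n := n) u_nf u'_nf) //.
  by apply: eqG_trans uw _; exact: eqG_sym.
rewrite cats0 in uw; rewrite (nf_inj u_nf w_nf uw).
exists [::], w; split => //.
by rewrite -{2}[w]cats0; exact: travels_catr.
Qed.
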